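(* Let $G$ be an oriented hypergraph with $n$ vertices, and let $v$ be a vertex of $G$. Then $$\lambda_{k+1}(L(G))\le\lambda_k(L(G\backslash v))\le\lambda_k(L(G))\quad\text{for all } k\in\{1,\dots,n-1\}.$$
   Context: An oriented hypergraph $G=(H,\sigma)$ consists of a finite hypergraph $H=(V,E,\mathcal{I})$ with vertex set $V=\{v_1,\dots,v_n\}$, a finite set $E$ of edges, each edge a (possibly empty) subset of $V$, and incidence set $\mathcal{I}$, together with an incidence orientation $\sigma:\mathcal{I}\to\{+1,-1\}$. Throughout, hypergraphs are simple: $(v,e)\in\mathcal{I}$ if and only if $v\in e$, each such pair occurring once. The degree $d_i$ of $v_i$ is the number of incidences containing $v_i$. For distinct $v_i,v_j\in e$, $\mathrm{sgn}_e(v_i,v_j)=-\sigma(v_i,e)\sigma(v_j,e)$. The adjacency matrix $A(G)=(a_{ij})$ has $a_{ij}=\sum_{e\in E:\, v_i,v_j\in e}\mathrm{sgn}_e(v_i,v_j)$ for $i\neq j$ and $a_{ii}=0$; $D(G)=\mathrm{diag}(d_1,\dots,d_n)$; the Laplacian is $L(G)=D(G)-A(G)$. The weak vertex-deletion $G\backslash v$ has vertex set $V\setminus\{v\}$, every edge $e$ retained but replaced by $e\setminus\{v\}$ (edges may become empty), all incidences containing $v$ removed, and the remaining incidences keeping their orientation. Eigenvalues of a real symmetric $N\times N$ matrix $M$ are ordered $\lambda_N(M)\le\cdots\le\lambda_1(M)$. *)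

(* Defs.v *)
From mathcomp Require Import all_boot all_order all_algebra.
From mathcomp Require Import polyrcf complex.
Set Implicit Arguments.
Unset Strict Implicit.
Unset Printing Implicit Defensive.
Import Order.TTheory GRing.Theory Num.Theory.
Local Open Scope ring_scope.

(* Edges are named and [ends e] is the vertex set of [e]: distinct edges may
   have equal (or empty) vertex sets, as weak deletion can make them so.
   For a simple hypergraph the incidence set is determined by membership. *)
Record hypergraph := Hypergraph {
  vertex : finType;
  edge : finType;
  ends : edge -> {set vertex}
}.

Definition incidence (H : hypergraph) : Type :=
  {p : vertex H * edge H | p.1 \in ends p.2}.

(* [orient i] encodes the sign (-1) ^+ orient i, i.e. [false] is +1 and
   [true] is -1. *)
Record oriented_hypergraph := OrientedHypergraph {
  hgraph :> hypergraph;
  orient : incidence hgraph -> bool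
}.

Section Matrices.
Variables (R : rcfType) (G : oriented_hypergraph).

Definition degree (u : vertex G) : nat :=
  #|[set i : incidence G | (val i).1 == u]|.

(* sigma(u, e), extended by the irrelevant value 0 to pairs that are not
   incidences. *)
Definition sigma (u : vertex G) (e : edge G) : R :=
  if insub (u, e) is Some i then (-1) ^+ orient (i : incidence G) else 0.

Definition sgn (e : edge G) (u w : vertex G) : R := - (sigma u e * sigma w e).

Definition adjacency : 'M[R]_#|vertex G| :=
  \matrix_(i, j)
    if i == j then 0
    else \sum_(e : edge G | (enum_val i \in ends e) && (enum_val j \in ends e))
           sgn e (enum_val i) (enum_val j).

Definition degree_mx : 'M[R]_#|vertex G| :=
  diag_mx (\row_i (degree (enum_val i))%:R).

Definition laplacian : 'M[R]_#|vertex G| := degree_mx - adjacency.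

End Matrices.

Section WeakDeletion.
Variables (G : oriented_hypergraph) (v : vertex G).

Definition weak_del_hgraph : hypergraph :=
  @Hypergraph {u : vertex G | u != v} (edge G)
    (fun e => [set u | val u \in ends e]).

Lemma weak_del_inc_proof (i : incidence weak_del_hgraph) :
  val (val i).1 \in ends ((val i).2 : edge G).
Proof. by have := valP i; rewrite inE. Qed.

Definition weak_del_inc (i : incidence weak_del_hgraph) : incidence G :=
  exist (fun p : vertex G * edge G => p.1 \in ends p.2)
    (val (val i).1, (val i).2) (weak_del_inc_proof i).

Definition weak_del : oriented_hypergraph :=
  @OrientedHypergraph weak_del_hgraph (fun i => orient (weak_del_inc i)).

End WeakDeletion.

Section Eigenvalues.
Variables (R : rcfType) (n : nat) (M : 'M[R]_n).

(* The eigenvalues of M in R, repeated according to their multiplicity as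
   roots of the characteristic polynomial, in nonincreasing order. *)
Definition eigenvalues : seq R :=
  sort >=%R (flatten [seq nseq (mup x (char_poly M)) x
                     | x <- rootsR (char_poly M)]).

(* Indexed from 1; the default value 0 is not reached for 1 <= k <= n when M
   is symmetric, see [size_eigenvalues] and [tr_laplacian]. *)
Definition lambda (k : nat) : R := nth 0 eigenvalues k.-1.

End Eigenvalues.

Lemma char_poly_conj (F : fieldType) n (P A : 'M[F]_n) : P \in unitmx ->
  char_poly (invmx P *m A *m P) = char_poly A.
Proof.
move=> Pu; rewrite /char_poly /char_poly_mx.
have Pu' : map_mx polyC P \in unitmx by rewrite map_unitmx.
rewrite [LHS](_ : _ = \det (invmx (map_mx polyC P) *m
   ('X%:M - map_mx polyC A) *m map_mx polyC P)).
  rewrite !det_mulmx mulrAC -det_mulmx.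
  by rewrite mulVmx // det1 mul1r.
congr (\det _).
rewrite mulmxBr mulmxBl !map_mxM /= map_invmx; congr (_ - _).
by rewrite scalar_mxC -mulmxA mulVmx // mulmx1.
Qed.

Lemma char_poly_split (R : rcfType) n (M : 'M[R]_n) : M^T = M ->
  exists s : seq R, char_poly M = \prod_(x <- s) ('X - x%:P).
Proof.
move=> sym; pose C : numClosedFieldType := R[i].
pose f : {rmorphism R -> C} := real_complex R.
pose A := map_mx f M.
have Ah : A \is hermsymmx.
  apply: realsym_hermsym.
    by apply/is_hermitianmxP; rewrite expr0 scale1r map_mx_id // /A -{1}sym;
    apply/matrixP => i j; rewrite !mxE.
  apply/mxOverP => i j; rewrite mxE; apply/complex_realP; by exists (M i j).
have /orthomx_spectralP eA := hermitian_normalmx Ah.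
have /mxOverP dr := hermitian_spectral_diag_real Ah.
exists [seq complex.Re (spectral_diag A 0 i) | i <- enum 'I_n].
apply: (@map_poly_inj _ _ f).
rewrite map_char_poly -/A [in LHS]eA char_poly_conj ?spectral_unit //.
rewrite char_poly_trig ?diag_mx_is_trig // rmorph_prod big_map big_enum.
apply: eq_bigr => i _ /=.
rewrite mxE eqxx mulr1n map_polyXsubC; congr ('X - _%:P).
by move: (RRe_real (dr 0 i)) => <-.
Qed.

Lemma char_poly_eigenvalues (R : rcfType) n (M : 'M[R]_n) : M^T = M ->
  char_poly M = \prod_(x <- eigenvalues M) ('X - x%:P).
Proof.
move=> /char_poly_split [s es]; rewrite es; apply: perm_big.
have p0 : char_poly M != 0 by rewrite monic_neq0 // char_poly_monic.
rewrite perm_sym /eigenvalues perm_sort; apply/allP => x _ /=; apply/eqP.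
rewrite -(mu_prod_XsubC x s) -es count_flatten -map_comp sumnE big_map.
under eq_bigr => y _ do rewrite /= count_nseq /=.
have ur : uniq (rootsR (char_poly M)) by apply: uniq_roots.
have [xr|xr] := boolP (x \in rootsR (char_poly M)).
  rewrite (bigD1_seq x) //= eqxx mul1n big1 ?addn0 // => y /negPf yx.
  by rewrite yx.
rewrite big1_seq ?mupNroot //.
  by move: xr; rewrite -roots_on_rootsR // in_itv.
by move=> y /andP[_ yr]; case: eqP => [yx|//]; rewrite -yx yr in xr.
Qed.

Lemma size_eigenvalues (R : rcfType) n (M : 'M[R]_n) : M^T = M ->
  size (eigenvalues M) = n.
Proof.
by move=> /char_poly_eigenvalues/(congr1 (size \o polyseq))/=;
  rewrite size_char_poly size_prod_XsubC => -[].
Qed.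

Lemma tr_laplacian (R : rcfType) G : (laplacian R G)^T = laplacian R G.
Proof.
rewrite /laplacian linearB /= /degree_mx tr_diag_mx; congr (_ - _).
apply/matrixP => i j; rewrite !mxE eq_sym; case: eqP => // _.
apply: eq_big => [e|e _]; first by rewrite andbC.
by rewrite /sgn mulrC.
Qed.

(* Main.v *)
(* For a real symmetric matrix M, the number of eigenvalues of M that are at
   least c is the largest dimension of a subspace of R[i]^n on which the
   hermitian form of M - c is nonnegative. Such subspaces can be pushed forward
   along the isometric embedding of a set of coordinates, and pulled back at a
   loss of at most the codimension, which gives Cauchy interlacing for
   principal submatrices; the Laplacian of G \ v is the principal submatrix of
   the Laplacian of G obtained by deleting the index of v. *)
Require Import Defs.
From mathcomp Require Import all_boot all_order all_algebra.
From mathcomp Require Import complex.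
Import Order.TTheory GRing.Theory Num.Theory.
Local Open Scope ring_scope.
Local Open Scope complex_scope.
Local Open Scope sesquilinear_scope.
Set Implicit Arguments.
Unset Strict Implicit.
Unset Printing Implicit Defensive.

(** The subspace is the row space of [W]. In a [numClosedFieldType], [0 <= z] also asserts that [z]
    is real. *)
Definition nonneg_on (C : numClosedFieldType) n p (B : 'M[C]_n)
    (W : 'M[C]_(p, n)) : Prop :=
  forall x : 'rV_n, (x <= W)%MS -> 0 <= (x *m B *m x^t*) 0 0.

(** * Inertia of a unitarily diagonalised form *)

Section Inertia.
Variables (C : numClosedFieldType) (n : nat).
Variables (P : 'M[C]_n) (d : 'rV[C]_n).
Hypotheses (Pu : P \is unitarymx) (dr : forall i, d 0 i \is Num.real).

Let B := invmx P *m diag_mx d *m P.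
Let S := [set i | 0 <= d 0 i].

Lemma diag_form (x : 'rV_n) (y := x *m P^t*) :
  (x *m B *m x^t*) 0 0 = \sum_i d 0 i * `|y 0 i| ^+ 2.
Proof.
have -> : x *m B *m x^t* = y *m diag_mx d *m y^t*.
  by rewrite /B invmx_unitary // trmx_mul map_mxM trmxCK !mulmxA.
rewrite mul_mx_diag !mxE; apply: eq_bigr => i _.
by rewrite !mxE normCK mulrAC mulrC.
Qed.

Lemma rowsub_unitary m (g : 'I_m -> 'I_n) : injective g ->
  rowsub g P \is unitarymx.
Proof.
move=> gI; apply/unitarymxP/matrixP => i j.
have /unitarymxP/matrixP/(_ (g i) (g j)) := Pu; rewrite !mxE (inj_eq gI) => <-.
by apply: eq_bigr => k _; rewrite !mxE.
Qed.

(** The rows of [P] are orthonormal, and entry [i] of [x *m P^t*] is the inner product of [x] with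
    row [i]. *)
Lemma span_coord_eq0 (T : {set 'I_n}) (x : 'rV_n) i :
  (x <= rowsub (@enum_val _ (mem T)) P)%MS -> i \notin T ->
  (x *m P^t*) 0 i = 0.
Proof.
move=> /submxP[u ->] iT; rewrite -mulmxA mul_rowsub_mx (unitarymxP Pu) !mxE.
rewrite big1 // => j _; rewrite !mxE; case: eqP => [ji|]; last by rewrite mulr0.
by have := enum_valP j; rewrite ji (negPf iT).
Qed.

Lemma nonneg_on_exists : exists2 W : 'M_n, \rank W = #|S| & nonneg_on B W.
Proof.
(* The span of the eigenvectors whose eigenvalue is nonnegative, made square by [<<_>>]. *)
exists <<rowsub (@enum_val _ (mem S)) P>>%MS.
  by rewrite genmxE mxrank_unitary // rowsub_unitary //; apply: enum_val_inj.
move=> x; rewrite genmxE => xS; rewrite diag_form sumr_ge0 // => i _.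
have [|iS] := boolP (i \in S); last first.
  by rewrite (span_coord_eq0 xS) // normr0 expr0n mulr0.
by rewrite inE => di; rewrite mulr_ge0 // exprn_ge0.
Qed.

(* A nonnegative subspace meets the span of the eigenvectors of negative
   eigenvalue trivially. *)
Lemma nonneg_on_rank p (W : 'M_(p, n)) : nonneg_on B W -> (\rank W <= #|S|)%N.
Proof.
move=> Wge; pose N := rowsub (@enum_val _ (mem (~: S))) P.
have rN : \rank N = #|~: S|.
  by rewrite mxrank_unitary // rowsub_unitary //; apply: enum_val_inj.
suff WN0 : (W :&: N = 0)%MS.
  have := rank_leq_col (W + N)%MS; rewrite mxrank_disjoint_sum // rN.
  by rewrite -[X in (_ <= X)%N]card_ord -(cardsC S) leq_add2r.
apply/eqP/rowV0P => x; rewrite sub_capmx => /andP[/Wge Wx xN].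
rewrite diag_form in Wx; set y := x *m P^t* in Wx.
have le0 i : d 0 i * `|y 0 i| ^+ 2 <= 0.
  have [iS|] := boolP (i \in ~: S); last first.
    by move=> iS; rewrite /y (span_coord_eq0 xN) // normr0 expr0n mulr0.
  rewrite mulr_le0_ge0 ?exprn_ge0 //.
  by move: iS; rewrite !inE -real_ltNge ?real0 // => /ltW.
(* A nonnegative sum of nonpositive terms has only zero terms; off [S] the factor [d 0 i] is
   nonzero, which forces [y 0 i = 0]. *)
have y0 : y = 0.
  apply/rowP => i; rewrite [RHS]mxE.
  have [iS|] := boolP (i \in ~: S); last exact: span_coord_eq0.
  have ge0 j : true -> 0 <= - (d 0 j * `|y 0 j| ^+ 2) by rewrite oppr_ge0.
  have: \sum_i - (d 0 i * `|y 0 i| ^+ 2) == 0.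
    by rewrite eq_le sumr_ge0 // sumrN oppr_le0 Wx.
  rewrite psumr_eq0 // => /allP/(_ i).
  rewrite mem_index_enum /= oppr_eq0 mulf_eq0 expf_eq0 normr_eq0 /=.
  move=> /(_ isT)/orP[/eqP d0|/eqP //].
  by move: iS; rewrite !inE d0 lexx.
by have := mulmxKtV x Pu erefl; rewrite -/y y0 mul0mx.
Qed.

End Inertia.

(** * Eigenvalue counts as dimensions of nonnegative subspaces *)

Section Counting.
Variables (R : rcfType) (n : nat) (M : 'M[R]_n).
Hypothesis symM : M^T = M.

Let shift c : 'M[R[i]]_n := map_mx (real_complex R) (M - c%:M).

Lemma count_eigenvalues c p :
  (p <= count (>= c) (eigenvalues M))%N <->
  exists2 W : 'M[R[i]]_n, (p <= \rank W)%N & nonneg_on (shift c) W.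
Proof.
pose f := real_complex R; pose A := map_mx f M.
have Ah : A \is hermsymmx.
  apply: realsym_hermsym.
    apply/is_hermitianmxP; rewrite expr0 scale1r map_mx_id //.
    by rewrite /A map_trmx symM.
  by apply/mxOverP => i j; rewrite mxE; apply/complex_realP; exists (M i j).
pose P := spectralmx A; pose e := spectral_diag A.
have Pu : P \is unitarymx by apply: spectral_unitarymx.
have eA : A = invmx P *m diag_mx e *m P.
  exact/orthomx_spectralP/hermitian_normalmx.
have er i : e 0 i \is Num.real.
  by have /mxOverP := hermitian_spectral_diag_real Ah; apply.
(* The basis that diagonalises [M] also diagonalises [M - c], with every eigenvalue lowered by
   [c]. *)
pose d : 'rV[R[i]]_n := \row_i (e 0 i - f c).
have dr i : d 0 i \is Num.real.
  by rewrite mxE rpredB //; apply/complex_realP; exists c.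
have -> : shift c = invmx P *m diag_mx d *m P.
  have -> : diag_mx d = diag_mx e - (f c)%:M.
    rewrite -diag_const_mx -linearB; congr diag_mx.
    by apply/rowP => i; rewrite !mxE.
  rewrite mulmxBr mulmxBl -eA /shift map_mxB map_scalar_mx; congr (_ - _).
  by rewrite scalar_mxC -mulmxA mulVmx ?mulmx1 ?unitarymx_unit.
have -> : count (>= c) (eigenvalues M) = #|[set i | 0 <= d 0 i]|.
  (* Both lists split the characteristic polynomial of [M] into linear factors, so they agree up to
     order. *)
  have pe : perm_eq (eigenvalues M) [seq complex.Re (e 0 i) | i <- enum 'I_n].
    apply: prod_XsubC_eq; rewrite -char_poly_eigenvalues //.
    apply: (@map_poly_inj _ _ f); rewrite map_char_poly -/A eA.
    rewrite char_poly_conj ?unitarymx_unit // char_poly_trig ?diag_mx_is_trig //.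
    rewrite rmorph_prod big_map big_enum; apply: eq_bigr => i _ /=.
    by rewrite mxE eqxx mulr1n map_polyXsubC; move: (RRe_real (er i)) => <-.
  have /permP -> := pe.
  rewrite count_map -sum1_count -sum1_card big_enum_cond /=.
  apply: eq_bigl => i; rewrite /= !inE mxE subr_ge0.
  by rewrite -(RRe_real (er i)) lecR.
split=> [pS|[W pW /(nonneg_on_rank Pu dr)/(leq_trans pW) //]].
by have [W rW Wge] := nonneg_on_exists d Pu; exists W; rewrite ?rW.
Qed.

Lemma le_lambda k c : (0 < k <= n)%N ->
  (c <= lambda M k) = (k <= count (>= c) (eigenvalues M))%N.
Proof.
case: k => // k /= kn; rewrite /lambda /=.
have srt : sorted >=%R (eigenvalues M).
  by apply: sort_sorted => x y; rewrite ge_total.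
(* In the dual order [R^d] the nonincreasing list of eigenvalues is nondecreasing, as the counting
   lemmas expect. *)
apply/idP/idP; last exact: (@nth_count_le _ R^d).
apply: contraTT; rewrite -leqNgt -ltNge => kc.
by apply: (@nth_count_gt _ R^d) => //; rewrite kc size_eigenvalues.
Qed.

End Counting.

(** * Cauchy interlacing for principal submatrices *)

Section Interlacing.
Variables (R : rcfType) (n m : nat) (M : 'M[R]_n) (g : 'I_m -> 'I_n).
Hypotheses (symM : M^T = M) (gI : injective g).

Let A c : 'M[R[i]]_n := map_mx (real_complex R) (M - c%:M).
Let B c : 'M[R[i]]_m := map_mx (real_complex R) (mxsub g g M - c%:M).
(** The isometric embedding of coordinates: [x *m U] places the entries of [x] at the positions
    given by [g] and zeros elsewhere. *)
Let U : 'M[R[i]]_(m, n) := rowsub g 1%:M.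

Let Uu : U *m U^t* = 1%:M.
Proof.
by apply/unitarymxP/rowsub_unitary => //; apply/unitarymxP;
  rewrite trmx1 map_mx1 mulmx1.
Qed.

Let U_free : row_free U.
Proof. by apply/row_freeP; exists (U^t*). Qed.

Lemma mxsub_form c (x : 'rV_m) :
  x *m B c *m x^t* = (x *m U) *m A c *m (x *m U)^t*.
Proof.
rewrite trmx_mul map_mxM -!mulmxA; congr (x *m _); rewrite !mulmxA.
congr (_ *m _).
rewrite mul_rowsub_mx mul1mx.
have -> : U^t* = colsub g 1%:M.
  by apply/matrixP => i j; rewrite !mxE conjC_nat eq_sym.
rewrite -mxsub_mul mulmx1; apply/matrixP => i j.
by rewrite !mxE (inj_eq gI).
Qed.

Let sym_mxsub : (mxsub g g M)^T = mxsub g g M.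
Proof. by rewrite trmx_mxsub symM. Qed.

Lemma le_lambda_mxsub k : (0 < k <= m)%N ->
  lambda (mxsub g g M) k <= lambda M k.
Proof.
move=> /andP[k0 km].
have mn : (m <= n)%N by have := leq_card g gI; rewrite !card_ord.
rewrite le_lambda ?k0 ?(leq_trans km mn) //; set c := lambda _ k.
(* With [c] the eigenvalue itself, this trivial bound becomes a count, hence a nonnegative subspace
   of dimension at least [k]. *)
have: c <= lambda (mxsub g g M) k by [].
rewrite le_lambda ?k0 // => /(count_eigenvalues sym_mxsub)[W rW Wge].
apply/(count_eigenvalues symM); exists <<W *m U>>%MS.
  by rewrite genmxE mxrankMfree.
move=> x; rewrite genmxE => /submxP[u ->].
by rewrite mulmxA -mxsub_form; apply: Wge; apply: submxMl.
Qed.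

Lemma lambda_mxsub_ge k : (0 < k <= m)%N ->
  lambda M (k + (n - m)) <= lambda (mxsub g g M) k.
Proof.
move=> /andP[k0 km].
have mn : (m <= n)%N by have := leq_card g gI; rewrite !card_ord.
rewrite le_lambda ?k0 //; set c := lambda M _.
have: c <= lambda M (k + (n - m)) by [].
have knm : (0 < k + (n - m) <= n)%N.
  by rewrite addn_gt0 k0 /= -[leqRHS](subnKC mn) leq_add2r.
rewrite le_lambda // => /(count_eigenvalues symM)[W rW Wge].
apply/(count_eigenvalues sym_mxsub).
(* [Z] is the pullback of [W] along the embedding: [Z *m U] spans the part of [W] inside the image
   of [U]. *)
have [Z eZ] := submxP (capmxSr W U).
exists <<Z>>%MS.
  rewrite genmxE -(mxrankMfree Z U_free) -eZ.
  have rU : \rank U = m by apply/eqP.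
  have := mxrank_sum_cap W U; rewrite rU => e.
  (* Dimension count: the intersection has rank at least [(k + (n - m)) + m - n = k]. *)
  rewrite -(leq_add2l n); apply: leq_trans (_ : (\rank W + m <= _)%N).
    by rewrite addnC -[in X in (X <= _)%N](subnK mn) addnA leq_add2r.
  by rewrite -e leq_add2r rank_leq_col.
move=> x; rewrite genmxE => xZ; rewrite mxsub_form; apply: Wge.
by apply: submx_trans (capmxSl W U); rewrite eZ submxMr.
Qed.

End Interlacing.

(** * Weak deletion as passage to a principal submatrix *)

Section WeakDeletionLaplacian.
Variables (R : rcfType) (G : oriented_hypergraph) (v : vertex G).

Definition weak_del_ord (i : 'I_#|vertex (weak_del v)|) : 'I_#|vertex G| :=
  enum_rank (val (enum_val i)).

Lemma weak_del_ord_inj : injective weak_del_ord.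
Proof. by move=> i j /enum_rank_inj/val_inj/enum_val_inj. Qed.

(** Only incidences at [v] disappear, so [weak_del_inc] maps the incidences at [u] bijectively onto
    those at [val u]. *)
Lemma degree_weak_del (u : vertex (weak_del v)) :
  degree u = degree (val u : vertex G).
Proof.
rewrite /degree -(card_imset _ (_ : injective (@weak_del_inc G v))); last first.
  move=> [[a e] p] [[b f] q] /(congr1 val) [/val_inj ab ef].
  by apply: val_inj; rewrite /= ab ef.
apply: eq_card => i; rewrite inE; apply/imsetP/idP => [[j]|/eqP iu].
  by rewrite inE => /eqP <- ->.
have iP : (u, (val i).2) \in [pred p : vertex (weak_del v) * edge (weak_del v)
             | p.1 \in ends p.2].
  by rewrite !inE /= -iu; apply: valP i.
exists (exist _ (u, (val i).2) iP : incidence (weak_del v)).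
  by rewrite inE /=.
by apply: val_inj; rewrite /= -iu -surjective_pairing.
Qed.

Lemma sigma_weak_del (u : vertex (weak_del v)) (e : edge G) :
  sigma R u (e : edge (weak_del v)) = sigma R (val u : vertex G) e.
Proof.
rewrite /sigma; case: insubP => [i ui vi|ui].
  have ue : (val u, e).1 \in ends (val u, e).2 by move: ui; rewrite inE.
  rewrite (insubT (fun p : vertex G * edge G => p.1 \in ends p.2) ue) /=.
  by congr (_ ^+ orient _); apply: val_inj; rewrite /= vi.
by rewrite insubN //; move: ui; rewrite inE.
Qed.

(** Every edge is retained with its signs, so degrees and adjacency sums at surviving vertices are
    unchanged. *)
Lemma laplacian_weak_del :
  laplacian R (weak_del v) = mxsub weak_del_ord weak_del_ord (laplacian R G).
Proof.
apply/matrixP => i j; rewrite !mxE /weak_del_ord !enum_rankK.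
rewrite (inj_eq enum_rank_inj) (inj_eq val_inj) (inj_eq enum_val_inj).
rewrite degree_weak_del; congr (_ - _); case: eqP => // _.
by apply: eq_big => [e|e _]; rewrite ?inE // /sgn !sigma_weak_del.
Qed.

End WeakDeletionLaplacian.

Theorem theorem4p9 (R : rcfType) (n : nat) (G : oriented_hypergraph)
    (hn : #|vertex G| = n) (v : vertex G) (k : nat) (hk : (1 <= k <= n - 1)%N) :
  lambda (laplacian R G) k.+1 <= lambda (laplacian R (weak_del v)) k /\
  lambda (laplacian R (weak_del v)) k <= lambda (laplacian R G) k.
Proof.
have cn : (#|vertex G| = #|vertex (weak_del v)|.+1)%N.
  rewrite (cardD1 v) inE add1n card_sig; congr _.+1.
  by apply: eq_card => u; rewrite !inE andbT.
have km : (0 < k <= #|vertex (weak_del v)|)%N.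
  by move: hk; rewrite -hn cn subn1.
have symL := tr_laplacian R G; have gI := @weak_del_ord_inj G v.
rewrite laplacian_weak_del; split; last exact: le_lambda_mxsub.
(* One vertex is deleted, so the codimension is 1 and the index shifts from [k] to [k.+1]. *)
by have := lambda_mxsub_ge symL gI km; rewrite [X in (X - _)%N]cn subSnn addn1.
Qed.
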